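(* Let $W$ be a $p\times p$ weight matrix function on $[a,b]$, with orthonormal matrix polynomials $P_0,P_1,P_2,\dots$, and let $n\ge1$. Let $(X,J)$ be a Jordan pair of $P_n(x)$; that is, let $x_1,\dots,x_k$ be the distinct zeros of $P_n$, let $m_i$ be the multiplicity of $x_i$, and let $v_{i,1},\dots,v_{i,m_i}\in\mathbb{R}^p$ be the columns of $X$ associated with $x_i$ (linearly independent non-zero vectors with $P_n(x_i)v_{i,j}=0$). Define $$L_i=\begin{pmatrix} v_{i,1}^T\\ \vdots\\ v_{i,m_i}^T\end{pmatrix}K_{n-1}(x_i,x_i)\,(v_{i,1}\ \cdots\ v_{i,m_i}),\qquad \Lambda_i=(v_{i,1}\ \cdots\ v_{i,m_i})\,L_i^{-1}\begin{pmatrix} v_{i,1}^T\\ \vdots\\ v_{i,m_i}^T\end{pmatrix},$$ where $K_{n-1}(x,y)=\sum_{j=0}^{n-1}P_j(y)^TP_j(x)$. Then the quadrature formula $$\int_a^bF(x)\,W(x)\,G(x)^T\,dx\simeq\sum_{i=1}^kF(x_i)\,\Lambda_i\,G(x_i)^T$$ is exact (i.e. holds with equality) for all $p\times p$ matrix polynomials $F(x)$ and $G(x)$ which satisfy $$\deg F(x)+\deg G(x)\le 2n-1.$$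
   Context: A weight matrix function on $[a,b]$ is a symmetric $p\times p$ real matrix-valued function $W(x)$, integrable over $[a,b]$ (with finite moments), such that $W(x)\ge 0$ (positive semidefinite) and $\det W(x)\ne 0$ almost everywhere on $[a,b]$; it is normalized by $\int_a^bW(x)\,dx=I$. The orthonormal matrix polynomials $P_n(x)$, with coefficients in $\mathbb{R}^{p\times p}$, satisfy $\int_a^bP_n(x)W(x)P_m(x)^T\,dx=\delta_{n,m}I$; $P_n$ has degree $n$ and non-singular leading coefficient, and is determined up to left multiplication by an orthogonal matrix. Integrals of matrix functions are taken entrywise; matrix polynomials have coefficients in $\mathbb{R}^{p\times p}$. A zero of $P_n$ is a point $x_0$ with $\det P_n(x_0)=0$, and its multiplicity is its multiplicity as a root of the polynomial $\det P_n$ (which has degree $np$, so $\sum_i m_i=np$). The zeros of $P_n$ are real, and all Jordan chains of $P_n$ have length $1$, so a Jordan pair of $P_n$ consists of $J=\mathrm{diag}(x_1,\dots,x_1,\dots,x_k,\dots,x_k)$, each $x_i$ repeated $m_i$ times, and $X=(v_{1,1}\ \cdots\ v_{1,m_1}\ \cdots\ v_{k,1}\ \cdots\ v_{k,m_k})$, where for each $i$ the vectors $v_{i,1},\dots,v_{i,m_i}$ are linearly independent with $P_n(x_i)v_{i,j}=0$. The matrices $L_i$ are symmetric positive definite, so $L_i^{-1}$ makes sense. *)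

(* Defs.v *)
From HB Require Import structures.
From mathcomp Require Import all_boot all_order all_algebra.
From mathcomp Require Import all_classical all_reals all_analysis.

Set Implicit Arguments.
Unset Strict Implicit.
Unset Printing Implicit Defensive.

Import Order.TTheory GRing.Theory Num.Theory.
Local Open Scope ring_scope.

(** * Matrix polynomials

    A p x p matrix polynomial is a matrix of polynomials, so that [\det P]
    is itself an element of [{poly R}]. *)

Section MatrixPolynomials.
Variables (R : realType) (p : nat).
Implicit Types P : 'M[{poly R}]_p.

Definition mxpeval P (x : R) : 'M[R]_p := map_mx (horner_eval x) P.

Definition mxpcoef P (k : nat) : 'M[R]_p := map_mx (coefp k) P.

(* The degree of a nonzero matrix polynomial; by truncation, mxpdeg 0 = 0. *)
Definition mxpdeg P : nat := (\max_i \max_j size (P i j)).-1.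

End MatrixPolynomials.

(** * Weights and orthonormal matrix polynomials *)

Section Weight.
Variables (R : realType) (p : nat) (a b : R).

Definition mxintegral (M : R -> 'M[R]_p) : 'M[R]_p :=
  \matrix_(i, j) \int[lebesgue_measure]_(x in `[a, b]) M x i j.

Definition possemidef (A : 'M[R]_p) : Prop :=
  forall v : 'cV[R]_p, 0 <= (v^T *m A *m v) 0 0.

Record weight_matrix (W : R -> 'M[R]_p) : Prop := WeightMatrix {
  weight_sym : forall x, x \in `[a, b] -> (W x)^T = W x;
  (* k = 0 is the integrability of W itself *)
  weight_moments : forall (k : nat) (i j : 'I_p),
    lebesgue_measure.-integrable `[a, b] (EFin \o (fun x => x ^+ k * W x i j));
  weight_pos : {ae lebesgue_measure, forall x : R, x \in `[a, b] ->
    possemidef (W x) /\ \det (W x) != 0};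
  weight_normalized : mxintegral W = 1%:M
}.

Record orthonormal_mxpolys (W : R -> 'M[R]_p) (P : nat -> 'M[{poly R}]_p) :
    Prop := OrthonormalMxpolys {
  ortho_deg : forall n, mxpdeg (P n) = n;
  ortho_lead : forall n, mxpcoef (P n) n \in unitmx;
  ortho_eq : forall n m,
    mxintegral (fun x => mxpeval (P n) x *m W x *m (mxpeval (P m) x)^T) =
    if n == m then 1%:M else 0
}.

End Weight.

(** * Jordan pairs and the quadrature weights *)

Section Quadrature.
Variables (R : realType) (p : nat).

(* Jordan pair (X, J) of a matrix polynomial Q all of whose Jordan chains have
   length 1: the x i are the distinct zeros of Q, m i is the multiplicity of
   x i as a root of \det Q, and [submxrow X i] is the block of the m i columns
   of X associated with x i. *)
Record jordan_pair (Q : 'M[{poly R}]_p) (k : nat) (x : 'I_k -> R)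
    (m : 'I_k -> nat) (X : 'M[R]_(p, \sum_i m i)) (J : 'M[R]_(\sum_i m i)) :
    Prop := JordanPair {
  jordan_inj : injective x;
  jordan_zeros : forall y : R, root (\det Q) y <-> exists i, x i = y;
  jordan_mult : forall i, m i = mup (x i) (\det Q);
  jordan_J : J = \mxdiag_(i < k) ((x i)%:M : 'M[R]_(m i));
  jordan_free : forall i, row_free (submxrow X i)^T;
  jordan_ker : forall i, mxpeval Q (x i) *m submxrow X i = 0
}.

(* mxkernel P n x y is the kernel K_{n-1}(x, y), with n terms. *)
Definition mxkernel (P : nat -> 'M[{poly R}]_p) (n : nat) (x y : R) : 'M[R]_p :=
  \sum_(j < n) (mxpeval (P j) y)^T *m mxpeval (P j) x.

Definition quadL (P : nat -> 'M[{poly R}]_p) (n : nat) (x : R) (d : nat)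
    (V : 'M[R]_(p, d)) : 'M[R]_d :=
  V^T *m mxkernel P n x x *m V.

Definition quadLambda (P : nat -> 'M[{poly R}]_p) (n : nat) (x : R) (d : nat)
    (V : 'M[R]_(p, d)) : 'M[R]_p :=
  V *m invmx (quadL P n x V) *m V^T.

End Quadrature.

(* Main.v *)
(* Write <F, G> for the integral of F W G^T.  The polynomials P_0, ..., P_(n-1)
   and X^s P_n (s >= 0) form a basis of the matrix polynomials over the constant
   matrices, and by symmetry one may assume deg G < n.  Both sides of the formula
   vanish when F = X^s P_n with s + deg G < n, so it remains to show that the
   quadrature sum reproduces the orthonormality of P_0, ..., P_(n-1).  This says
   H D^-1 H^T = 1, where H has the blocks P_l(x_i) V_i and D = diag(L_i).  The
   Christoffel-Darboux formula gives H^T H = D, so it is enough that H be square,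
   i.e. that the multiplicities m_i sum to np: the complex roots of det P_n are
   all real because multiplication by X is self-adjoint for <., .>. *)
Require Import Defs.
From mathcomp Require Import all_boot all_order all_algebra.
From mathcomp Require Import all_classical all_reals all_analysis.
From mathcomp Require Import perm ring zify.
From mathcomp.real_closed Require Import complex.
Import Order.TTheory GRing.Theory Num.Theory.
Set Implicit Arguments.
Unset Strict Implicit.
Unset Printing Implicit Defensive.
Local Open Scope ring_scope.

Local Notation "A ^%:P" := (map_mx polyC A) (at level 2, format "A ^%:P").

(** * Evaluation, size bounds, expansion in a graded basis, and Gram matrices *)

Section MatrixPolynomials.
Context {R : realType} {p : nat}.
Implicit Types (A C : 'M[R]_p) (F G : 'M[{poly R}]_p) (x y z : R).

Lemma mxpevalM F G x : mxpeval (F *m G) x = mxpeval F x *m mxpeval G x.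
Proof. exact: map_mxM. Qed.

Lemma mxpevalD F G x : mxpeval (F + G) x = mxpeval F x + mxpeval G x.
Proof. exact: map_mxD. Qed.

Lemma mxpeval_sum I (r : seq I) (P : pred I) (F : I -> 'M[{poly R}]_p) x :
  mxpeval (\sum_(i <- r | P i) F i) x = \sum_(i <- r | P i) mxpeval (F i) x.
Proof. exact: raddf_sum. Qed.

Lemma mxpevalC A x : mxpeval A^%:P x = A.
Proof. by apply/matrixP => i j; rewrite !mxE horner_evalE hornerC. Qed.

Lemma mxpevalZ (f : {poly R}) F x : mxpeval (f *: F) x = f.[x] *: mxpeval F x.
Proof. by apply/matrixP => i j; rewrite !mxE !horner_evalE hornerM. Qed.

Lemma mxpevalX F x : mxpeval ('X *: F) x = x *: mxpeval F x.
Proof. by rewrite mxpevalZ hornerX. Qed.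

Lemma mxpcoefCM A F k : mxpcoef (A^%:P *m F) k = A *m mxpcoef F k.
Proof.
by apply/matrixP => i j; rewrite !mxE /coefp coef_sum; apply: eq_bigr => l _;
  rewrite !mxE coefCM /coefp.
Qed.

(** Sizes are bounded instead of degrees so that [N = 0] characterises the zero polynomial, which
    the truncated [mxpdeg] does not separate from constants. *)
Definition mxsize_le (N : nat) F := forall i j, (size (F i j) <= N)%N.

Lemma mxsize_le_mxpdeg F : mxsize_le (mxpdeg F).+1 F.
Proof.
move=> i j; apply: leq_trans (leqSpred _).
apply: leq_trans (leq_bigmax i); exact: (leq_bigmax j).
Qed.

Lemma mxsize_leW N M F : (N <= M)%N -> mxsize_le N F -> mxsize_le M F.
Proof. by move=> NM sF i j; apply: leq_trans NM. Qed.

Lemma mxsize_leCM N A F : mxsize_le N F -> mxsize_le N (A^%:P *m F).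
Proof.
move=> sF i j; rewrite mxE; apply: (leq_trans (size_sum _ _ _)).
apply/bigmax_leqP => l _; rewrite mxE mul_polyC.
exact: leq_trans (size_scale_leq _ _) (sF _ _).
Qed.

Lemma mxsize_leD N F G : mxsize_le N F -> mxsize_le N G -> mxsize_le N (F + G).
Proof.
move=> sF sG i j; rewrite mxE.
by apply: (leq_trans (size_polyD _ _)); rewrite geq_max sF sG.
Qed.

Lemma mxsize_le_sum N I (r : seq I) (P : pred I) (F : I -> 'M[{poly R}]_p) :
  (forall i, P i -> mxsize_le N (F i)) -> mxsize_le N (\sum_(i <- r | P i) F i).
Proof.
move=> sF; apply: (big_ind (mxsize_le N)) => //; last exact: mxsize_leD.
by move=> i j; rewrite mxE size_poly0.
Qed.

Lemma mxsize_leXn N s F : mxsize_le N F -> mxsize_le (s + N) ('X^s *: F).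
Proof.
move=> sF i j; rewrite mxE; apply: (leq_trans (size_polyMleq _ _)).
by rewrite size_polyXn addSn /= leq_add2l.
Qed.

Lemma mxsize_le_coef N F :
  mxsize_le N.+1 F -> mxpcoef F N = 0 -> mxsize_le N F.
Proof.
move=> sF /matrixP F0 i j; apply/leq_sizeP => k; rewrite leq_eqVlt.
case/predU1P=> [<-|Nk]; first by have := F0 i j; rewrite !mxE /coefp.
by move/leq_sizeP: (sF i j); apply.
Qed.

Definition mxbasis (Q : nat -> 'M[{poly R}]_p) :=
  forall j, mxsize_le j.+1 (Q j) /\ mxpcoef (Q j) j \in unitmx.

(** Division from the top: since the leading coefficient of [Q N] is invertible, a left multiple of
    [Q N] cancels the coefficient of degree [N], and induction handles the rest. *)
Lemma mxbasis_expand Q N F : mxbasis Q -> mxsize_le N F ->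
  exists C : nat -> 'M[R]_p, F = \sum_(j < N) (C j)^%:P *m Q j.
Proof.
move=> hQ; elim: N F => [|N IHN] F sF.
  exists (fun=> 0); rewrite big_ord0; apply/matrixP => i j.
  by apply/eqP; rewrite mxE -size_poly_leq0 sF.
have [sQ uQ] := hQ N.
pose A := mxpcoef F N *m invmx (mxpcoef (Q N) N).
have [|C defF] := IHN (F - A^%:P *m Q N).
  apply: mxsize_le_coef.
    apply: mxsize_leD => // i j; rewrite mxE size_polyN; exact: mxsize_leCM.
  rewrite /mxpcoef map_mxB -!/(mxpcoef _ _) mxpcoefCM.
  by rewrite mulmxKV // subrr.
exists (fun j => if j == N then A else C j).
rewrite big_ord_recr /= eqxx -[LHS](subrK (A^%:P *m Q N)) defF; congr (_ + _).
by apply: eq_bigr => j _; rewrite ltn_eqF.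
Qed.

Lemma mxtrace_gram m d (A : 'M[R]_(m, d)) :
  \tr (A *m A^T) = \sum_i \sum_j A i j ^+ 2.
Proof.
apply: eq_bigr => i _; rewrite mxE; apply: eq_bigr => j _.
by rewrite mxE expr2.
Qed.

Lemma mxtrace_gram_ge0 m d (A : 'M[R]_(m, d)) : 0 <= \tr (A *m A^T).
Proof.
by rewrite mxtrace_gram; apply: sumr_ge0 => i _; apply: sumr_ge0 => j _;
  exact: sqr_ge0.
Qed.

Lemma mxtrace_gram_eq0 m d (A : 'M[R]_(m, d)) : \tr (A *m A^T) = 0 -> A = 0.
Proof.
rewrite mxtrace_gram => /eqP; rewrite psumr_eq0; last first.
  by move=> i _; apply: sumr_ge0 => j _; exact: sqr_ge0.
move/allP => A0; apply/matrixP => i j; have := A0 i (mem_index_enum _).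
rewrite /= psumr_eq0 => [/allP/(_ j (mem_index_enum _))|? _]; last exact: sqr_ge0.
by rewrite /= sqrf_eq0 mxE => /eqP.
Qed.

(** The trace turns matrix positivity into a scalar statement: it is a sum of squares of entries, so
    it vanishes only if every entry does. *)
Lemma mxtrace_sum_gram_eq0 (I : finType) m d (A : I -> 'M[R]_(m, d)) :
  \tr (\sum_i A i *m (A i)^T) = 0 -> forall i, A i = 0.
Proof.
rewrite raddf_sum => /eqP; rewrite psumr_eq0 => [/allP A0 i|i _]; last first.
  exact: mxtrace_gram_ge0.
by apply: mxtrace_gram_eq0; apply/eqP; apply: A0; apply: mem_index_enum.
Qed.

End MatrixPolynomials.

(** * Symmetric matrix-valued forms *)

(** These are the algebraic properties shared by the integral and the quadrature sum; expansions
    proved from them apply to both sides of the formula. *)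
Record mxform (R : realType) (p : nat)
    (B : 'M[{poly R}]_p -> 'M[{poly R}]_p -> 'M[R]_p) : Prop := Mxform {
  mxformDl : forall F1 F2 G, B (F1 + F2) G = B F1 G + B F2 G;
  mxformMl : forall A F G, B (A^%:P *m F) G = A *m B F G;
  mxformT : forall F G, (B F G)^T = B G F;
  mxformX : forall F G, B ('X *: F) G = B F ('X *: G)
}.

Section Form.
Context {R : realType} {p : nat}.
Context {B : 'M[{poly R}]_p -> 'M[{poly R}]_p -> 'M[R]_p}.
Hypothesis hB : mxform B.
Implicit Types (A C : 'M[R]_p) (F G : 'M[{poly R}]_p) (x y z : R).

Lemma mxform0l G : B 0 G = 0.
Proof.
by apply: (addrI (B 0 G)); rewrite -(mxformDl hB) !addr0.
Qed.

Lemma mxform_suml I (r : seq I) (P : pred I) (F : I -> 'M[{poly R}]_p) G :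
  B (\sum_(i <- r | P i) F i) G = \sum_(i <- r | P i) B (F i) G.
Proof.
exact: (big_morph (B^~ G) (fun F1 F2 => mxformDl hB F1 F2 G) (mxform0l G)).
Qed.

Lemma mxformMr A F G : B F (A^%:P *m G) = B F G *m A^T.
Proof. by rewrite -(mxformT hB) (mxformMl hB) trmx_mul (mxformT hB). Qed.

Lemma mxform_sumr I (r : seq I) (P : pred I) F (G : I -> 'M[{poly R}]_p) :
  B F (\sum_(i <- r | P i) G i) = \sum_(i <- r | P i) B F (G i).
Proof.
rewrite -(mxformT hB) mxform_suml raddf_sum.
by apply: eq_bigr => i _; rewrite /= (mxformT hB).
Qed.

Lemma polyC_scalar_mxE (c : R) F : c%:P *: F = (c%:M)^%:P *m F.
Proof. by rewrite map_scalar_mx mul_scalar_mx. Qed.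

Lemma mxformZl (c : R) F G : B (c%:P *: F) G = c *: B F G.
Proof. by rewrite polyC_scalar_mxE (mxformMl hB) mul_scalar_mx. Qed.

Lemma mxformXn s F G : B ('X^s *: F) G = B F ('X^s *: G).
Proof.
elim: s F => [|s IHs] F; first by rewrite expr0 !scale1r.
by rewrite exprSr -scalerA IHs (mxformX hB) scalerA -exprS exprSr.
Qed.

End Form.

(** * Fourier expansion, the reproducing kernel and Christoffel-Darboux *)

Section OrthonormalBasis.
Context {R : realType} {p : nat}.
Context {B : 'M[{poly R}]_p -> 'M[{poly R}]_p -> 'M[R]_p}.
Hypothesis hB : mxform B.
Context {P : nat -> 'M[{poly R}]_p}.
Hypothesis hP : mxbasis P.
Hypothesis orthP : forall j l, B (P j) (P l) = if j == l then 1%:M else 0.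
Implicit Types (A C : 'M[R]_p) (F G : 'M[{poly R}]_p) (x y z : R).

Lemma mxform_ortho n G : mxsize_le n G -> B (P n) G = 0.
Proof.
move=> /(mxbasis_expand hP)[C ->]; rewrite (mxform_sumr hB) big1 // => j _.
by rewrite (mxformMr hB) orthP gtn_eqF // mul0mx.
Qed.

Lemma mxform_fourier n F :
  mxsize_le n F -> F = \sum_(j < n) (B F (P j))^%:P *m P j.
Proof.
move=> /(mxbasis_expand hP)[C defF]; rewrite {1}defF; apply: eq_bigr => j _.
congr (map_mx _ _ *m _); rewrite defF (mxform_suml hB) (bigD1 j) //=.
rewrite (mxformMl hB) orthP eqxx mulmx1 big1 ?addr0 // => i ij.
by rewrite (mxformMl hB) orthP ifN ?mulmx0.
Qed.

Lemma mxform_parseval n F :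
  mxsize_le n F -> B F F = \sum_(j < n) B F (P j) *m (B F (P j))^T.
Proof.
move=> sF; rewrite {2}(mxform_fourier sF) (mxform_sumr hB).
by apply: eq_bigr => j _; rewrite (mxformMr hB).
Qed.

(** Positivity is read off Parseval's identity, which writes [B F F] as a sum of Gram matrices. *)
Lemma mxform_tr_ge0 n F : mxsize_le n F -> 0 <= \tr (B F F).
Proof.
move=> sF; rewrite (mxform_parseval sF) raddf_sum.
by apply: sumr_ge0 => j _; apply: mxtrace_gram_ge0.
Qed.

Lemma mxform_tr_eq0 n F : mxsize_le n F -> \tr (B F F) = 0 -> F = 0.
Proof.
move=> sF; rewrite (mxform_parseval sF) => /mxtrace_sum_gram_eq0 F0.
rewrite (mxform_fourier sF) big1 // => j _.
by rewrite F0 map_mx0 mul0mx.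
Qed.

(** The kernel as a polynomial in its first argument, the second being frozen at [y], so that a form
    can be applied to it. *)
Definition mxkernel_poly n y : 'M[{poly R}]_p :=
  \sum_(j < n) ((mxpeval (P j) y)^T)^%:P *m P j.

Lemma mxkernel_polyE n y z : mxpeval (mxkernel_poly n y) z = mxkernel P n z y.
Proof.
rewrite mxpeval_sum; apply: eq_bigr => j _.
by rewrite mxpevalM mxpevalC.
Qed.

Lemma mxsize_le_mxkernel n y : mxsize_le n (mxkernel_poly n y).
Proof.
apply: mxsize_le_sum => j _; apply: mxsize_leCM.
exact: mxsize_leW (ltn_ord j) (hP j).1.
Qed.

Lemma trmx_mxkernel n y z : (mxkernel P n y z)^T = mxkernel P n z y.
Proof.
by rewrite raddf_sum; apply: eq_bigr => j _; rewrite /= trmx_mul trmxK.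
Qed.

(** Pairing with the kernel gives the sum of the [B F (P j) *m mxpeval (P j) y], which is the
    Fourier expansion of [F] evaluated at [y]. *)
Lemma mxform_reproducing n F y :
  mxsize_le n F -> B F (mxkernel_poly n y) = mxpeval F y.
Proof.
move=> sF; rewrite {2}(mxform_fourier sF) mxpeval_sum (mxform_sumr hB).
by apply: eq_bigr => j _; rewrite (mxformMr hB) trmxK mxpevalM mxpevalC.
Qed.

(** Multiplication by ['X] may raise the degree to [n], one beyond the reach of the kernel. The
    defect is the component along [P n], whose coefficient [D] is the same for all [z]. *)
Lemma mxform_reproducingX n F : mxsize_le n F -> exists D, forall z,
  B ('X *: F) (mxkernel_poly n z) = z *: mxpeval F z - D *m mxpeval (P n) z.
Proof.
move=> sF; have sXF : mxsize_le n.+1 ('X *: F) by exact: (@mxsize_leXn _ _ n 1).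
have defXF := mxform_fourier sXF; rewrite big_ord_recr /= in defXF.
exists (B ('X *: F) (P n)) => z.
rewrite {1}defXF (mxformDl hB) (mxformMl hB).
rewrite (mxform_ortho (mxsize_le_mxkernel n z)) mulmx0 addr0.
rewrite mxform_reproducing; last first.
  apply: mxsize_le_sum => j _; apply: mxsize_leCM.
  exact: mxsize_leW (ltn_ord j) (hP j).1.
rewrite -mxpevalX {2}defXF mxpevalD mxpevalM mxpevalC.
by rewrite addrK.
Qed.

(* Multiplication by X is self-adjoint, so the two reproducing formulas for
   [B (X K_y) K_z] and [B K_y (X K_z)] agree: this is a Christoffel-Darboux
   formula for [(z - y) K(z, y)]. *)
Lemma mxkernel_ortho n y z d1 d2 (V : 'M[R]_(p, d1)) (V' : 'M[R]_(p, d2)) :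
  y != z -> mxpeval (P n) y *m V = 0 -> mxpeval (P n) z *m V' = 0 ->
  V^T *m mxkernel P n z y *m V' = 0.
Proof.
move=> yz PV PV'.
have [D hD] := mxform_reproducingX (mxsize_le_mxkernel n y).
have [E hE] := mxform_reproducingX (mxsize_le_mxkernel n z).
have := mxformT hB ('X *: mxkernel_poly n z) (mxkernel_poly n y).
rewrite -(mxformX hB) hD hE !mxkernel_polyE linearB linearZ /= trmx_mxkernel.
(* Sandwiching between [V^T] and [V'] kills both defect terms, leaving [y - z] times the desired
   product equal to zero. *)
rewrite trmx_mul => /(congr1 (fun M => V^T *m M *m V')).
rewrite !mulmxBr !mulmxBl -!scalemxAr -!scalemxAl !mulmxA -trmx_mul PV.
rewrite -[_ *m D *m _ *m _]mulmxA PV' trmx0 !mul0mx mulmx0 !subr0 => /eqP.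
rewrite -subr_eq0 -scalerBl scaler_eq0 subr_eq0 (negPf yz) => /eqP //.
Qed.

(** If [u] annihilates the matrix, then the Gram matrices of the [u V^T P_j(x)^T] have total trace
    zero. The term [j = 0], present because [n > 0], already gives [u V^T = 0], as [P 0] is an
    invertible constant. *)
Lemma quadL_unit n x d (V : 'M[R]_(p, d)) :
  (0 < n)%N -> row_free V^T -> quadL P n x V \in unitmx.
Proof.
case: n => // n _ freeV; rewrite -row_free_unit; apply: inj_row_free => u uL.
pose w (j : 'I_n.+1) := u *m V^T *m (mxpeval (P j) x)^T.
have w0 : w ord0 = 0.
  apply: mxtrace_sum_gram_eq0.
  transitivity (\tr (u *m quadL P n.+1 x V *m u^T)); last first.
    by rewrite uL mul0mx raddf0.
  congr (\tr _); rewrite /quadL /mxkernel !(mulmx_sumr, mulmx_suml).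
  by apply: eq_bigr => j _; rewrite /w !trmx_mul !trmxK !mulmxA.
have uP0 : (mxpeval (P 0) x)^T \in unitmx.
  rewrite unitmx_tr; have [sP0] := hP 0; congr (_ \in unitmx).
  apply/matrixP => i j; rewrite !mxE /coefp horner_evalE.
  by rewrite [in RHS](size1_polyC (sP0 i j)) hornerC.
have /eqP : u *m V^T = 0.
  by rewrite -[LHS](mulmxK uP0) -/(w ord0) w0 mul0mx.
by rewrite -[0](mul0mx _ V^T) => /eqP/(row_free_inj freeV).
Qed.

End OrthonormalBasis.

(** * Real and imaginary parts of polynomials; polynomials with only real roots *)

Section RealRoots.
Context {R : realType}.
Implicit Types (f g : {poly R[i]}) (q : {poly R}) (l c : R[i]).

Local Notation toC := (real_complex R).
Local Notation re := (map_poly (@complex.Re R)).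
Local Notation im := (map_poly (@complex.Im R)).

Lemma coef_re f k : (re f)`_k = complex.Re f`_k.
Proof. exact: coef_map_id0. Qed.

Lemma coef_im f k : (im f)`_k = complex.Im f`_k.
Proof. exact: coef_map_id0. Qed.

Lemma size_re f : (size (re f) <= size f)%N.
Proof. exact: size_poly. Qed.

Lemma size_im f : (size (im f) <= size f)%N.
Proof. exact: size_poly. Qed.

Lemma re_XsubCM l f :
  re (('X - l%:P) * f) =
  ('X - (complex.Re l)%:P) * re f + (complex.Im l)%:P * im f.
Proof.
apply/polyP => k; rewrite coef_re !mulrBl !(coefB, coefD) !coefXM !coefCM.
rewrite coef_im !coef_re.
case: (f`_k) l => a b [c d]; case: k => [|k] /=; first by ring.
by case: (f`_k) => a' b' /=; ring.
Qed.

Lemma im_XsubCM l f :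
  im (('X - l%:P) * f) =
  ('X - (complex.Re l)%:P) * im f - (complex.Im l)%:P * re f.
Proof.
apply/polyP => k; rewrite coef_im !mulrBl !coefB !coefXM !coefCM.
rewrite coef_re !coef_im.
case: (f`_k) l => a b [c d]; case: k => [|k] /=; first by ring.
by case: (f`_k) => a' b' /=; ring.
Qed.

Lemma re_mulmx p (C : 'M[R[i]]_p) (F : 'M[{poly R}]_p) :
  map_mx re (C^%:P *m map_mx (map_poly toC) F) =
  (map_mx (@complex.Re R) C)^%:P *m F.
Proof.
apply/matrixP => i j; rewrite !mxE; apply/polyP => k.
rewrite coef_re !coef_sum.
rewrite (big_morph (@complex.Re R) (id1 := 0) (op1 := +%R)) //; last first.
  by move=> [? ?] [? ?].
apply: eq_bigr => m _; rewrite !mxE !coefCM coef_map /=.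
by case: (C i m) => a b /=; ring.
Qed.

Lemma im_mulmx p (C : 'M[R[i]]_p) (F : 'M[{poly R}]_p) :
  map_mx im (C^%:P *m map_mx (map_poly toC) F) =
  (map_mx (@complex.Im R) C)^%:P *m F.
Proof.
apply/matrixP => i j; rewrite !mxE; apply/polyP => k.
rewrite coef_im !coef_sum.
rewrite (big_morph (@complex.Im R) (id1 := 0) (op1 := +%R)) //; last first.
  by move=> [? ?] [? ?].
apply: eq_bigr => m _; rewrite !mxE !coefCM coef_map /=.
by case: (C i m) => a b /=; ring.
Qed.

(** Over [R[i]] the polynomial splits; its roots equal their real parts, and injectivity of the
    embedding brings the factorization back to [R]. *)
Lemma real_roots_split q :
  (forall l, root (map_poly toC q) l -> complex.Im l = 0) -> q != 0 ->
  exists s : seq R, q = lead_coef q *: \prod_(z <- s) ('X - z%:P).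
Proof.
move=> real_q q0; have [r] := closed_field_poly_normal (map_poly toC q).
rewrite lead_coef_map => defq; exists (map (@complex.Re R) r).
apply: (map_poly_inj toC); rewrite {1}defq map_polyZ rmorph_prod.
congr (_ *: _); rewrite big_map big_seq [RHS]big_seq; apply: eq_bigr => z rz.
rewrite rmorphB /= map_polyX map_polyC /=; congr ('X - _%:P).
have := real_q z; rewrite defq rootZ ?root_prod_XsubC; last first.
  by rewrite fmorph_eq0 lead_coef_eq0.
by case: z rz => a b /= rz ->.
Qed.

(** Multiplicities are occurrence counts in the root list [s], and each member of [s] is counted by
    exactly one index [i]. *)
Lemma sum_mup_split q k (x : 'I_k -> R) (s : seq R) :
  q != 0 -> q = lead_coef q *: \prod_(z <- s) ('X - z%:P) ->
  injective x -> (forall y, root q y -> exists i, x i = y) ->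
  (\sum_i mup (x i) q)%N = (size q).-1.
Proof.
move=> q0 defq x_inj x_roots.
have lq0 : lead_coef q != 0 by rewrite lead_coef_eq0.
have -> : (size q).-1 = size s.
  by rewrite defq size_scale // size_prod_XsubC.
transitivity (\sum_i count_mem (x i) s)%N.
  apply: eq_bigr => i _; rewrite {1}defq -mul_polyC mupMr ?rootC //.
  exact: mu_prod_XsubC.
have {x_roots} : {subset s <= codom x}.
  move=> y sy; have [|i <-] := x_roots y; last exact: codom_f.
  by rewrite defq rootZ // root_prod_XsubC.
elim: s {defq} => [|y s IHs] /= s_x; first by rewrite big1.
rewrite big_split /= IHs => [|z sz]; last by rewrite s_x // inE sz orbT.
have /codomP[i ->] := s_x y (mem_head _ _).
rewrite (bigD1 i) //= eqxx big1 // => j ji.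
by rewrite (inj_eq x_inj) eq_sym (negPf ji).
Qed.

End RealRoots.

(** * The degree of the determinant *)

Section DetDegree.
Context {R : realType}.

Lemma coefM_top (f g : {poly R}) a b :
  (size f <= a.+1)%N -> (size g <= b.+1)%N -> (f * g)`_(a + b) = f`_a * g`_b.
Proof.
move=> /leq_sizeP sf /leq_sizeP sg; rewrite coefM.
have la : (a < (a + b).+1)%N by rewrite ltnS leq_addr.
rewrite (bigD1 (Ordinal la)) //= addKn big1 ?addr0 // => i.
rewrite -val_eqE neq_ltn => /orP[/= ia|/= ai]; last by rewrite sf ?mul0r.
by rewrite sg ?mulr0 //; move: ia; lia.
Qed.

Lemma coef_prod_top m n (f : 'I_m -> {poly R}) :
  (forall i, (size (f i) <= n.+1)%N) ->
  (size (\prod_i f i)%R <= (m * n).+1)%N /\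
  (\prod_i f i)`_(m * n) = \prod_i (f i)`_n.
Proof.
elim: m f => [|m IHm] f sf.
  by rewrite !big_ord0 size_polyC oner_eq0 coefC.
rewrite !big_ord_recr /= mulSn addnC.
have [//|s1 c1] := IHm (fun i => f (widen_ord (leqnSn m) i)).
split; last by rewrite coefM_top ?c1.
apply: (leq_trans (size_polyMleq _ _)).
by move: (leq_add s1 (sf ord_max)) => /=; lia.
Qed.

(** In the Leibniz formula each product has [p] factors of degree at most [n], and its coefficient
    at [p * n] is the product of their coefficients at [n]. *)
Lemma det_coef_top p n (F : 'M[{poly R}]_p) : mxsize_le n.+1 F ->
  (size (\det F) <= (p * n).+1)%N /\ (\det F)`_(p * n) = \det (mxpcoef F n).
Proof.
move=> sF; have top (s : 'S_p) := coef_prod_top (fun i => sF i (s i)).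
split.
  apply: (leq_trans (size_sum _ _ _)); apply/bigmax_leqP => s _.
  by rewrite mulr_sign; case: (odd_perm s); rewrite ?size_polyN (top s).1.
rewrite coef_sum; apply: eq_bigr => s _; rewrite !mulr_sign.
have -> : \prod_i mxpcoef F n i (s i) = \prod_i (F i (s i))`_n.
  by apply: eq_bigr => i _; rewrite mxE.
by rewrite -(top s).2; case: (odd_perm s); rewrite ?coefN.
Qed.

Lemma size_det_mxbasis p (P : nat -> 'M[{poly R}]_p) n :
  mxbasis P -> size (\det (P n)) = (p * n).+1.
Proof.
move=> hP; have [sP uP] := hP n; have [sdet cdet] := det_coef_top sP.
apply/eqP; rewrite eqn_leq sdet ltnNge; apply/negP => /leq_sizeP/(_ _ (leqnn _)).
by rewrite cdet => det0; move: uP; rewrite unitmxE det0 unitr0.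
Qed.

End DetDegree.

(** * Reality of the zeros and the count of multiplicities *)

Section OrthonormalRoots.
Context {R : realType} {p : nat}.
Context {B : 'M[{poly R}]_p -> 'M[{poly R}]_p -> 'M[R]_p}.
Hypothesis hB : mxform B.
Context {P : nat -> 'M[{poly R}]_p}.
Hypothesis hP : mxbasis P.
Hypothesis orthP : forall j l, B (P j) (P l) = if j == l then 1%:M else 0.

(* If [C P_n(l) = 0] then [C P_n = (X - l) f] with [deg f < n], and [C P_n] is
   orthogonal to [f]; for [f = U + i V] the real and imaginary parts give
   [Im l * (<U, U> + <V, V>) = 0]. *)
Lemma det_ortho_root_real n (l : R[i]) :
  root (map_poly (real_complex R) (\det (P n))) l -> complex.Im l = 0.
Proof.
move=> rl; apply/eqP/negPn/negP => Iml.
pose PC := map_mx (map_poly (real_complex R)) (P n).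
(* The whole left kernel matrix is taken instead of one null row, which keeps all matrices [p] by
   [p] and so within the scope of [B]. *)
pose Pl := map_mx (horner_eval l) PC; pose C := kermx Pl.
have CP0 : C *m Pl = 0 by apply: mulmx_ker.
have C0 : C != 0.
  rewrite kermx_eq0 row_free_unit unitmxE !det_map_mx /= /horner_eval.
  by rewrite (rootP rl) unitr0.
pose f := map_mx (fun g => g %/ ('X - l%:P)) (C^%:P *m PC).
have deff : C^%:P *m PC = ('X - l%:P) *: f.
  apply/matrixP => i j; rewrite !mxE mulrC divpK // dvdp_XsubCl.
  move/matrixP/(_ i j): CP0; rewrite !mxE => CPij; apply/rootP.
  rewrite horner_sum -[RHS]CPij; apply: eq_bigr => m _.
  by rewrite !mxE hornerM hornerC horner_evalE.
have [sP uP] := hP n.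
have sf : forall i j, (size (f i j) <= n)%N.
  move=> i j; rewrite mxE size_divp ?polyXsubC_eq0 // size_XsubC /=.
  rewrite leq_subLR add1n mxE; apply: (leq_trans (size_sum _ _ _)).
  apply/bigmax_leqP => m _; rewrite !mxE mul_polyC.
  by apply: (leq_trans (size_scale_leq _ _)); rewrite size_map_poly.
pose U := map_mx (map_poly (@complex.Re R)) f.
pose V := map_mx (map_poly (@complex.Im R)) f.
have sU : mxsize_le n U.
  by move=> i j; rewrite mxE (leq_trans (size_re _)).
have sV : mxsize_le n V.
  by move=> i j; rewrite mxE (leq_trans (size_im _)).
set a := complex.Re l; set b := complex.Im l.
have reE : (map_mx (@complex.Re R) C)^%:P *m P n =
           ('X *: U - a%:P *: U) + b%:P *: V.
  rewrite -re_mulmx -/PC deff -scalerBl; apply/matrixP => i j.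
  by rewrite !mxE re_XsubCM.
have imE : (map_mx (@complex.Im R) C)^%:P *m P n =
           ('X *: V - a%:P *: V) - b%:P *: U.
  rewrite -im_mulmx -/PC deff -scalerBl; apply/matrixP => i j.
  by rewrite !mxE im_XsubCM.
have orthC (A : 'M[R]_p) F : mxsize_le n F -> B (A^%:P *m P n) F = 0.
  by move=> sF; rewrite (mxformMl hB) (mxform_ortho hB hP orthP sF) mulmx0.
have mxformNl F G : B (- F) G = - B F G.
  by apply: (addrI (B F G)); rewrite -(mxformDl hB) !subrr (mxform0l hB).
(* The real part is paired with [V] and the imaginary part with [U]: after transposing one relation,
   the terms in ['X] and [a] agree, and only those in [b] survive the comparison. *)
have UV := orthC (map_mx (@complex.Re R) C) V sV.
have VU := orthC (map_mx (@complex.Im R) C) U sU.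
move: UV VU; rewrite reE imE !(mxformDl hB, mxformNl, mxformZl hB).
move=> UV /(congr1 trmx); rewrite !linearD !linearN /= !linearZ /=.
rewrite !(mxformT hB) trmx0 !scalerN -(mxformX hB) => VU.
have {UV VU} : b *: (B U U + B V V) = 0.
  by rewrite scalerDr -(subr0_eq VU).
move/eqP; rewrite scaler_eq0 (negPf Iml) /= => /eqP/(congr1 mxtrace).
rewrite raddfD raddf0 /= => /eqP.
have tr_ge0 := mxform_tr_ge0 hB hP orthP.
rewrite paddr_eq0 ?(tr_ge0 n) // => /andP[/eqP trU /eqP trV].
have U0 : U = 0 := mxform_tr_eq0 hB hP orthP sU trU.
have V0 : V = 0 := mxform_tr_eq0 hB hP orthP sV trV.
(* With [U] and [V] zero, the real and imaginary parts of [C] annihilate [P n]; its invertible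
   leading coefficient forces [C = 0], a contradiction. *)
have zero (A : 'M[R]_p) : A^%:P *m P n = 0 -> A = 0.
  move=> AP; have : A *m mxpcoef (P n) n = 0.
    by rewrite -mxpcoefCM AP; apply/matrixP => i j; rewrite !mxE /coefp coef0.
  by move/(congr1 (mulmx^~ (invmx (mxpcoef (P n) n)))); rewrite mulmxK ?mul0mx.
case/eqP: C0; apply/matrixP => i j; apply/eqP; rewrite mxE eq_complex.
rewrite U0 V0 !scaler0 !subr0 addr0 in reE imE.
have /matrixP/(_ i j) := zero _ reE; rewrite !mxE => ->.
by have /matrixP/(_ i j) := zero _ imE; rewrite !mxE => ->; rewrite eqxx.
Qed.

Lemma sum_mup_det_ortho n k (x : 'I_k -> R) : injective x ->
  (forall y, root (\det (P n)) y -> exists i, x i = y) ->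
  (\sum_i mup (x i) (\det (P n)))%N = (p * n)%N.
Proof.
have sdet := size_det_mxbasis n hP.
have det0 : \det (P n) != 0 by rewrite -size_poly_gt0 sdet.
have [s defs] := real_roots_split (@det_ortho_root_real n) det0.
by move=> x_inj x_roots; rewrite (sum_mup_split det0 defs) // sdet.
Qed.

End OrthonormalRoots.

(** The two dimensions in use, the sum of the multiplicities and [n] copies of [p], are equal only
    by a proof, so commutation of inverses is transported along it. *)
Lemma mulmx1C_cast (R : comUnitRingType) m n (A : 'M[R]_(m, n))
    (C : 'M[R]_(n, m)) : m = n -> A *m C = 1%:M -> C *m A = 1%:M.
Proof. by move=> e; case: n / e in A C *; apply: mulmx1C. Qed.

(** * The quadrature form and its exactness *)

Section Quadrature.
Context {R : realType} {p : nat}.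
Context {B : 'M[{poly R}]_p -> 'M[{poly R}]_p -> 'M[R]_p}.
Hypothesis hB : mxform B.
Context {P : nat -> 'M[{poly R}]_p}.
Hypothesis hP : mxbasis P.
Hypothesis orthP : forall j l, B (P j) (P l) = if j == l then 1%:M else 0.
Context {n k : nat} {x : 'I_k -> R} {m : 'I_k -> nat}.
Context {X : 'M[R]_(p, \sum_i m i)} {J : 'M[R]_(\sum_i m i)}.
Hypothesis n_gt0 : (0 < n)%N.
Hypothesis hXJ : jordan_pair (P n) x X J.
Implicit Types (F G : 'M[{poly R}]_p).

Let V i : 'M[R]_(p, m i) := submxrow X i.
Let L i := quadL P n (x i) (V i).

Definition quadrature F G : 'M[R]_p :=
  \sum_(i < k) mxpeval F (x i) *m quadLambda P n (x i) (submxrow X i)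
    *m (mxpeval G (x i))^T.

Lemma trmx_quadLambda y d (U : 'M[R]_(p, d)) :
  (quadLambda P n y U)^T = quadLambda P n y U.
Proof.
rewrite /quadLambda !trmx_mul trmxK trmx_inv mulmxA /quadL !trmx_mul trmxK.
by rewrite trmx_mxkernel mulmxA.
Qed.

Lemma mxform_quadrature : mxform quadrature.
Proof.
split=> [F1 F2 G|A F G|F G|F G].
- rewrite -big_split; apply: eq_bigr => i _.
  by rewrite mxpevalD !mulmxDl.
- rewrite mulmx_sumr; apply: eq_bigr => i _.
  by rewrite mxpevalM mxpevalC !mulmxA.
- rewrite raddf_sum; apply: eq_bigr => i _ /=.
  by rewrite trmx_mul trmxK trmx_mul trmx_quadLambda mulmxA.
- apply: eq_bigr => i _.
  by rewrite !mxpevalX linearZ /= -!scalemxAl -scalemxAr.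
Qed.

(** Each weight has the block of null vectors of [P n] at its node as left factor. *)
Lemma quadrature_lead s G : quadrature ('X^s *: P n) G = 0.
Proof.
rewrite /quadrature big1 // => i _.
rewrite mxpevalZ /quadLambda !mulmxA -!scalemxAl (jordan_ker hXJ).
by rewrite !mul0mx scaler0.
Qed.

(* With [H = (P_l(x_i) V_i)_{l,i}], the Christoffel-Darboux formula gives
   [H^T H = diag(L_i)]; as [\sum_i m_i = np], the matrix [H] is square and
   [H diag(L_i)^-1 H^T = 1]. *)
Lemma quadrature_ortho j l : (j < n)%N -> (l < n)%N ->
  quadrature (P j) (P l) = if j == l then 1%:M else 0.
Proof.
move=> jn ln.
pose H := \mxblock_(j < n, i < k) (mxpeval (P j) (x i) *m V i).
(* This is the inverse of the block diagonal of the [L i] times the transpose of [H], the candidate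
   inverse of [H]. *)
pose H' := \mxblock_(i < k, j < n)
  (invmx (L i) *m (mxpeval (P j) (x i) *m V i)^T).
have HH : H' *m H = 1%:M.
  rewrite mul_mxblock -mxdiagZ; apply: eq_mxblock => i i'.
  transitivity (invmx (L i) *m ((V i)^T *m mxkernel P n (x i') (x i) *m V i')).
    rewrite /mxkernel !(mulmx_sumr, mulmx_suml); apply: eq_bigr => r _.
    by rewrite trmx_mul !mulmxA.
  case: eqVneq => [<-|ii'].
    rewrite conform_mx_id mulVmx //.
    exact: (quadL_unit hP _ n_gt0 (jordan_free hXJ i)).
  rewrite (mxkernel_ortho hB hP orthP) ?mulmx0 ?(inj_eq (jordan_inj hXJ)) //;
    exact: (jordan_ker hXJ).
have HH' : H *m H' = 1%:M.
  apply: mulmx1C_cast HH.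
  rewrite (eq_bigr _ (fun i _ => jordan_mult hXJ i)).
  rewrite (sum_mup_det_ortho hB hP orthP (jordan_inj hXJ)); last first.
    by move=> y; apply: (jordan_zeros hXJ y).1.
  by rewrite sum_nat_const card_ord mulnC.
(* The blocks of [H *m H'] are the quadrature values; [conform_mx] comes from the encoding of block
   diagonal matrices and is the identity here. *)
have /eq_mxblockP/(_ (Ordinal jn) (Ordinal ln)) :
    \mxblock_(j < n, l < n) quadrature (P j) (P l) =
    \mxblock_(j < n, l < n) (if j == l then conform_mx 0 (1%:M : 'M[R]_p) else 0).
  rewrite -[RHS]/(\mxdiag_(i < n) (1%:M : 'M[R]_p)) mxdiagZ -HH' mul_mxblock.
  apply: eq_mxblock => j' l'; apply: eq_bigr => i _.
  by rewrite /quadLambda trmx_mul !mulmxA.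
by rewrite conform_mx_id.
Qed.

(** Sizes exceed degrees by one, so for nonzero polynomials the bounds correspond to total degree at
    most [2n - 1] and to [G] of degree below [n]. *)
Lemma quadrature_exact_le F G N M : (N + M <= n.*2.+1)%N -> (M <= n)%N ->
  mxsize_le N F -> mxsize_le M G -> B F G = quadrature F G.
Proof.
move=> NM Mn sF sG.
(* From index [n] on, multiples of [P n] replace the orthonormal polynomials because the quadrature
   sum vanishes on them. *)
pose Q j := if (j < n)%N then P j else 'X^(j - n) *: P n.
have hQ : mxbasis Q.
  move=> j; rewrite /Q; case: ltnP => [_|nj]; first exact: hP.
  have [sP uP] := hP n; split.
    by rewrite -{1}(subnK nj) -addnS; apply: mxsize_leXn.
  congr (_ \in unitmx): uP; apply/matrixP => r c.
  by rewrite !mxE /coefp coefXnM ltnNge leq_subr subKn.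
have [C ->] := mxbasis_expand hQ sF.
have hq := mxform_quadrature.
rewrite (mxform_suml hB) (mxform_suml hq); apply: eq_bigr => j _.
rewrite (mxformMl hB) (mxformMl hq) /Q; congr (_ *m _); case: ltnP => nj.
  have [D ->] := mxbasis_expand hP sG.
  rewrite (mxform_sumr hB) (mxform_sumr hq); apply: eq_bigr => l _.
  rewrite (mxformMr hB) (mxformMr hq) orthP quadrature_ortho //.
  exact: leq_trans Mn.
(* The power of ['X] moves to [G]; as [j < N], the size [(j - n) + M] is at most [n], and [P n] is
   orthogonal to the result. *)
rewrite quadrature_lead (mxformXn hB) (mxform_ortho hB hP orthP) //.
apply: mxsize_leW (mxsize_leXn _ sG); have := ltn_ord j; lia.
Qed.

Lemma quadrature_exact F G :
  (F != 0 -> G != 0 -> (mxpdeg F + mxpdeg G <= 2 * n - 1)%N) ->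
  B F G = quadrature F G.
Proof.
move=> hFG; have hq := mxform_quadrature.
have [->|F0] := eqVneq F 0; first by rewrite (mxform0l hB) (mxform0l hq).
have [->|G0] := eqVneq G 0.
  by rewrite -(mxformT hB) -(mxformT hq) (mxform0l hB) (mxform0l hq).
have sF := mxsize_le_mxpdeg F; have sG := mxsize_le_mxpdeg G.
have {hFG} := hFG F0 G0; have [Gn|nG] := ltnP (mxpdeg G) n => dFG.
  by apply: quadrature_exact_le sF sG => //; lia.
(* Here [G] has degree at least [n], so [F] has degree below [n]; transposition exchanges their
   roles. *)
rewrite -(mxformT hB) -(mxformT hq); congr (_^T).
by apply: quadrature_exact_le sG sF; lia.
Qed.

End Quadrature.

(** * Integration of finite sums *)

Section RintegralSum.
Context d (T : measurableType d) (R : realType) (mu : {measure set T -> \bar R}).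
Context {D : set T} {I : Type} {f : I -> T -> R}.
Hypothesis mD : measurable D.
Hypothesis intf : forall i, mu.-integrable D (EFin \o f i).

Lemma integrable_EFin_sum (s : seq I) :
  mu.-integrable D (EFin \o (fun t => \sum_(i <- s) f i t)).
Proof.
rewrite (_ : _ \o _ = fun t => (\sum_(i <- s) (f i t)%:E)%E).
  by apply: integrable_sum => // i _; exact: intf.
by apply/funext => t /=; rewrite sumEFin.
Qed.

Lemma Rintegral_sum (s : seq I) :
  \int[mu]_(t in D) (\sum_(i <- s) f i t) = \sum_(i <- s) \int[mu]_(t in D) f i t.
Proof.
elim: s => [|i s IHs].
  rewrite big_nil /Rintegral integral0_eq // => t _.
  by rewrite big_nil.
rewrite big_cons -IHs -RintegralD //; last exact: integrable_EFin_sum.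
by apply: eq_Rintegral => t _; rewrite big_cons.
Qed.

End RintegralSum.

(** * The form defined by the weight *)

Section IntegralForm.
Context {R : realType} {p : nat} {a b : R} {W : R -> 'M[R]_p}.
Hypothesis hW : weight_matrix a b W.
Local Notation mu := (@lebesgue_measure R).
Implicit Types (f g : {poly R}) (F G : 'M[{poly R}]_p).

Lemma integrable_horner_weight f i j :
  mu.-integrable `[a, b] (EFin \o (fun t => f.[t] * W t i j)).
Proof.
rewrite (_ : _ \o _ =
    fun t => (\sum_(s < size f) (f`_s)%:E * (t ^+ s * W t i j)%:E)%E).
  by apply: integrable_sum => // s _; apply: integrableZl => //;
    exact: (weight_moments hW).
apply/funext => t /=; rewrite horner_coef mulr_suml -sumEFin.
by apply: eq_bigr => s _; rewrite -EFinM mulrA.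
Qed.

(** Integration enters the form only through these functionals on scalar polynomials; their
    linearity reduces the properties of the form to polynomial algebra. *)
Definition weight_moment i j f : R := \int[mu]_(t in `[a, b]) (f.[t] * W t i j).

Lemma weight_momentD i j f g :
  weight_moment i j (f + g) = weight_moment i j f + weight_moment i j g.
Proof.
rewrite /weight_moment -RintegralD //; try exact: integrable_horner_weight.
by apply: eq_Rintegral => t _; rewrite hornerD mulrDl.
Qed.

Lemma weight_momentZ i j c f :
  weight_moment i j (c *: f) = c * weight_moment i j f.
Proof.
rewrite /weight_moment -RintegralZl //; last exact: integrable_horner_weight.
by apply: eq_Rintegral => t _; rewrite hornerZ mulrA.
Qed.

Lemma weight_moment_sum i j I (r : seq I) (P : pred I) (f : I -> {poly R}) :
  weight_moment i j (\sum_(l <- r | P l) f l) =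
  \sum_(l <- r | P l) weight_moment i j (f l).
Proof.
apply: (big_morph _ (weight_momentD i j)).
by rewrite -[0 in LHS](scale0r 0) weight_momentZ mul0r.
Qed.

Lemma weight_momentC i j f : weight_moment i j f = weight_moment j i f.
Proof.
apply: eq_Rintegral => t; rewrite inE => /= tab.
by rewrite -[in LHS](weight_sym hW tab) mxE.
Qed.

Definition weight_form F G : 'M[R]_p :=
  mxintegral a b (fun t => mxpeval F t *m W t *m (mxpeval G t)^T).

Lemma weight_formE F G i j :
  weight_form F G i j = \sum_r \sum_s weight_moment r s (F i r * G j s).
Proof.
transitivity (\int[mu]_(t in `[a, b])
    \sum_r \sum_s ((F i r * G j s).[t] * W t r s)).
  rewrite mxE; apply: eq_Rintegral => t _; rewrite mxE exchange_big.
  apply: eq_bigr => s _; rewrite mxE mulr_suml; apply: eq_bigr => r _.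
  by rewrite !mxE !horner_evalE hornerM mulrAC.
rewrite Rintegral_sum // => [|r]; last first.
  by apply: integrable_EFin_sum => // s; exact: integrable_horner_weight.
apply: eq_bigr => r _; rewrite Rintegral_sum // => s.
exact: integrable_horner_weight.
Qed.

Lemma mxform_weight : mxform weight_form.
Proof.
split=> [F1 F2 G|A F G|F G|F G]; apply/matrixP => i j.
- rewrite [RHS]mxE !weight_formE -big_split; apply: eq_bigr => r _.
  rewrite -big_split; apply: eq_bigr => s _.
  by rewrite mxE mulrDl weight_momentD.
- rewrite weight_formE [RHS]mxE.
  under [RHS]eq_bigr do rewrite weight_formE mulr_sumr.
  rewrite [RHS]exchange_big; apply: eq_bigr => r _.
  under [RHS]eq_bigr do rewrite mulr_sumr.
  rewrite [RHS]exchange_big; apply: eq_bigr => s _.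
  rewrite mxE mulr_suml weight_moment_sum; apply: eq_bigr => l _.
  by rewrite mxE -mulrA mul_polyC weight_momentZ.
- rewrite [LHS]mxE !weight_formE exchange_big; apply: eq_bigr => r _.
  by apply: eq_bigr => s _; rewrite weight_momentC mulrC.
- rewrite !weight_formE; apply: eq_bigr => r _; apply: eq_bigr => s _.
  by rewrite !mxE mulrCA mulrA.
Qed.

End IntegralForm.

Lemma mxbasis_orthonormal (R : realType) (p : nat) (a b : R)
    (W : R -> 'M[R]_p) (P : nat -> 'M[{poly R}]_p) :
  orthonormal_mxpolys a b W P -> mxbasis P.
Proof.
move=> hP j; split; last exact: (ortho_lead hP).
by rewrite -{1}(ortho_deg hP j); apply: mxsize_le_mxpdeg.
Qed.

(* The degree condition is only required when F and G are both nonzero, the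
   zero polynomial having degree -oo. *)
Theorem theorem5p2 (R : realType) (p : nat) (a b : R)
    (W : R -> 'M[R]_p) (P : nat -> 'M[{poly R}]_p) (n : nat)
    (k : nat) (x : 'I_k -> R) (m : 'I_k -> nat)
    (X : 'M[R]_(p, \sum_i m i)) (J : 'M[R]_(\sum_i m i))
    (hW : weight_matrix a b W)
    (hP : orthonormal_mxpolys a b W P)
    (hn : (1 <= n)%N)
    (hXJ : jordan_pair (P n) x X J)
    (F G : 'M[{poly R}]_p)
    (hFG : F != 0 -> G != 0 -> (mxpdeg F + mxpdeg G <= 2 * n - 1)%N) :
  mxintegral a b (fun t => mxpeval F t *m W t *m (mxpeval G t)^T) =
  \sum_(i < k) mxpeval F (x i) *m quadLambda P n (x i) (submxrow X i)
                 *m (mxpeval G (x i))^T.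
Proof.
exact: (quadrature_exact (mxform_weight hW) (mxbasis_orthonormal hP)
          (ortho_eq hP) hn hXJ hFG).
Qed.
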